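(* Let $e\in KG$ be an idempotent, and let $\rho_e:KG\to KG$ be the $FG$-linear projector defined by $\rho_e(x)=xe$. Let $\star\in\{\mathrm{TE},\mathrm{TH}\}$, where the case $\star=\mathrm{TH}$ is considered only when $m$ is even. Then the following conditions are equivalent: (1) The additive left group code $FGe=\rho_e(FG)\subseteq KG$ is $\star$-LCD. (2) For every $x\in FG$, if $\langle xe,ye\rangle_\star=0$ for all $y\in FG$, then $xe=0$. (3) The form $\widetilde{B}_e:FG\times FG\to F$ defined by $\widetilde{B}_e(x,y)=\langle xe,ye\rangle_\star$ induces a non-degenerate form on $FG/\ker(\rho_e|_{FG})$, where $\ker(\rho_e|_{FG})=\{x\in FG:xe=0\}=FG\cap KG(1-e)$. (4) If $x_1,\dots,x_n$ is any $F$-basis of $FG$ and $M_e=\bigl(\langle x_ie,x_je\rangle_\star\bigr)_{1\le i,j\le n}$, then $\operatorname{rank}(M_e)=\dim_F(FGe)$.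
   Context: $F=\mathbb{F}_q$ is a finite field, $K=\mathbb{F}_{q^m}$ is its extension of degree $m$, $G$ is a finite group of order $n$, and $FG\subseteq KG$ are the group algebras. An additive left group code is a left $FG$-submodule $C\leq KG$. For $x=\sum_{g\in G}a_g g$ and $y=\sum_{g\in G}b_g g$ in $KG$, $\langle x,y\rangle_{\mathrm{TE}}=\operatorname{Tr}_{K/F}\left(\sum_{g\in G}a_gb_g\right)$ and, when $m$ is even, $\langle x,y\rangle_{\mathrm{TH}}=\operatorname{Tr}_{K/F}\left(\sum_{g\in G}a_g\overline{b_g}\right)$, where $\overline{b}=b^{q^{m/2}}$. For a code $C$, $C^{\perp_\star}=\{x\in KG:\langle x,c\rangle_\star=0\text{ for all }c\in C\}$ (taken in the ambient space $KG$), and $C$ is $\star$-LCD if $C\cap C^{\perp_\star}=\{0\}$. $FGe=\{xe:x\in FG\}$ is called the restricted idempotent additive left group code associated with $e$. *)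

(* Defs.v *)
From HB Require Import structures.
From mathcomp Require Import all_boot all_order all_fingroup all_algebra.
From mathcomp Require Import all_field.

Set Implicit Arguments.
Unset Strict Implicit.
Unset Printing Implicit Defensive.

Import GRing.Theory.
Local Open Scope ring_scope.
Local Open Scope quotient_scope.

(* The group algebra A[G] = A (x)_F F[G] of the whole finite group gT, with   *)
(* coefficients in an F-algebra A, as an F-algebra: sum_g a_g g is the        *)
(* function g |-> a_g.  Taking A := F^o and A := K gives FG and KG.  It is    *)
(* not {ffun gT -> A} itself, whose library product is pointwise.             *)
Definition group_algebra (F : fieldType) (A : falgType F) (gT : finGroupType)
  : predArgType := {ffun gT -> A}.

Section GroupAlgebra.
Variables (F : fieldType) (A : falgType F) (gT : finGroupType).
Local Notation AG := (group_algebra A gT).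
Implicit Types a b c : AG.

HB.instance Definition _ := Vector.copy AG {ffun gT -> A}.

Definition ga_coef a (g : gT) : A := (a : {ffun gT -> A}) g.

Definition ga_one : AG := [ffun g => (g == 1%g)%:R].

Definition ga_mul a b : AG :=
  [ffun g => \sum_(h : gT) ga_coef a h * ga_coef b (h^-1 * g)%g].

Lemma ga_mulA : associative ga_mul.
Proof.
move=> a b c; apply/ffunP=> g; rewrite !ffunE.
under eq_bigr => h _ do rewrite /ga_coef ffunE mulr_sumr.
under [RHS]eq_bigr => h _ do rewrite {1}/ga_coef ffunE mulr_suml.
rewrite [RHS]exchange_big /=; apply: eq_bigr => h _.
rewrite [RHS](reindex_inj (mulgI h)) /=; apply: eq_bigr => k _.
by rewrite mulrA mulKg invMg mulgA.
Qed.

Lemma ga_mul1 : left_id ga_one ga_mul.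
Proof.
move=> a; apply/ffunP=> g; rewrite ffunE (bigD1 1%g) //= big1 ?addr0.
  by rewrite /ga_coef ffunE eqxx mul1r invg1 mul1g.
by move=> h /negPf hn1; rewrite {1}/ga_coef ffunE hn1 mul0r.
Qed.

Lemma ga_mulr1 : right_id ga_one ga_mul.
Proof.
move=> a; apply/ffunP=> g; rewrite ffunE (bigD1 g) //= big1 ?addr0.
  by rewrite /ga_coef ffunE mulVg eqxx mulr1.
move=> h hng; rewrite [X in _ * X]/ga_coef ffunE -eq_mulVg1.
by rewrite (negPf hng) mulr0.
Qed.

Lemma ga_mulDl : left_distributive ga_mul +%R.
Proof.
move=> a b c; apply/ffunP=> g; rewrite !ffunE -big_split /=.
by apply: eq_bigr => h _; rewrite /ga_coef !ffunE mulrDl.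
Qed.

Lemma ga_mulDr : right_distributive ga_mul +%R.
Proof.
move=> a b c; apply/ffunP=> g; rewrite !ffunE -big_split /=.
by apply: eq_bigr => h _; rewrite /ga_coef !ffunE mulrDr.
Qed.

Lemma ga_one_neq0 : ga_one != 0.
Proof.
apply/eqP=> /ffunP/(_ 1%g) /eqP.
by rewrite !ffunE eqxx oner_eq0.
Qed.

HB.instance Definition _ := GRing.Zmodule_isNzRing.Build AG
  ga_mulA ga_mul1 ga_mulr1 ga_mulDl ga_mulDr ga_one_neq0.

Lemma ga_scalerAl (k : F) a b : k *: (a * b) = (k *: a) * b.
Proof.
apply/ffunP=> g; rewrite !ffunE scaler_sumr.
by apply: eq_bigr => h _; rewrite /ga_coef !ffunE scalerAl.
Qed.

HB.instance Definition _ := GRing.Lmodule_isLalgebra.Build F AG ga_scalerAl.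

Lemma ga_scalerAr (k : F) a b : k *: (a * b) = a * (k *: b).
Proof.
apply/ffunP=> g; rewrite !ffunE scaler_sumr.
by apply: eq_bigr => h _; rewrite /ga_coef !ffunE scalerAr.
Qed.

HB.instance Definition _ := GRing.Lalgebra_isAlgebra.Build F AG ga_scalerAr.
HB.instance Definition _ := Algebra_isFalgebra.Build F AG.

End GroupAlgebra.

Section QuotientSpace.
Variables (F : fieldType) (V : vectType F) (U : {vspace V}).

Definition quotient_space : Type := Quotient.quot U.

HB.instance Definition _ := EqQuotient.on quotient_space.
HB.instance Definition _ := GRing.Zmodule.on quotient_space.

Definition qs_scale (a : F) : quotient_space -> quotient_space :=
  lift_op1 quotient_space ( *:%R a).

Lemma pi_qs_scale a : {morph \pi_quotient_space : x / a *: x >-> qs_scale a x}.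
Proof.
move=> x; unlock qs_scale; apply/eqP; rewrite piE Quotient.equivE.
rewrite -scalerBr; apply: memvZ.
by rewrite (@Quotient.idealrBE _ U) reprK.
Qed.

Lemma pi_qs_add : {morph \pi_quotient_space : x y / x + y}.
Proof. by move=> x y; rewrite [LHS]Quotient.pi_add. Qed.

Lemma qs_scaleA a b x : qs_scale a (qs_scale b x) = qs_scale (a * b) x.
Proof. by rewrite -[x]reprK -!pi_qs_scale scalerA. Qed.

Lemma qs_scale1 : left_id 1 qs_scale.
Proof. by move=> x; rewrite -[x]reprK -pi_qs_scale scale1r. Qed.

Lemma qs_scaleDr : right_distributive qs_scale +%R.
Proof.
move=> a x y; rewrite -[x]reprK -[y]reprK.
by rewrite -pi_qs_add -!pi_qs_scale -pi_qs_add scalerDr.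
Qed.

Lemma qs_scaleDl x : {morph qs_scale^~ x : a b / a + b}.
Proof.
by move=> a b; rewrite -[x]reprK -!pi_qs_scale -pi_qs_add scalerDl.
Qed.

HB.instance Definition _ := GRing.Zmodule_isLmodule.Build F quotient_space
  qs_scaleA qs_scale1 qs_scaleDr qs_scaleDl.

Lemma pi_qs_linear : linear \pi_quotient_space.
Proof. by move=> a x y; rewrite pi_qs_add pi_qs_scale. Qed.

Lemma pi_qs_eq0 x : (\pi_quotient_space x == 0) = (x \in U).
Proof.
rewrite -[X in X \in U]subr0 (@Quotient.idealrBE _ U).
by congr (_ == _); rewrite piE.
Qed.

End QuotientSpace.

Definition nondegenerate_form (F : fieldType) (V : lmodType F)
    (B : V -> V -> F) : Prop :=
  (forall x, (forall y, B x y = 0) -> x = 0) /\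
  (forall y, (forall x, B x y = 0) -> y = 0).

Section Trace.
Variables (F : finFieldType) (K : fieldExtType F).
Local Notation L := (FinSplittingFieldType F K).

(* galTrace is K-valued; field_trace a is the scalar it represents, see       *)
(* field_traceE.  Every finite extension of a finite field is splitting.      *)
Definition field_trace (a : K) : F :=
  odflt 0 [pick c : F | c%:A == galTrace 1 {:L} a].

Lemma field_traceE (a : K) : (field_trace a)%:A = galTrace 1 {:L} a.
Proof.
rewrite /field_trace; case: pickP => [c /eqP //|noc] /=.
have /vlineP[c trc] : galTrace 1 {:L} a \in 1%VS.
  by rewrite mem_galTrace ?memvf // finField_galois ?subvf.
by have := noc c; rewrite trc eqxx.
Qed.

End Trace.

Section RestrictedIdempotentCode.
Variables (F : finFieldType) (K : fieldExtType F) (gT : finGroupType).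
Local Notation FG := (group_algebra F^o gT).
Local Notation KG := (group_algebra K gT).

Definition FG_incl (x : FG) : KG := [ffun g => (ga_coef x g : F)%:A].

Lemma FG_incl_linear : linear FG_incl.
Proof.
move=> a x y; apply/ffunP=> g.
by rewrite !ffunE /ga_coef !ffunE scalerDl scalerA.
Qed.

HB.instance Definition _ := GRing.isLinear.Build F FG KG _ FG_incl
  FG_incl_linear.

Lemma FG_incl_monoid_morphism : monoid_morphism FG_incl.
Proof.
split=> [|x y]; apply/ffunP=> g; rewrite !ffunE /ga_coef.
  by rewrite ffunE scaler_nat.
rewrite ffunE scaler_suml; apply: eq_bigr => h _.
by rewrite /ga_coef !ffunE -scalerAl mul1r scalerA.
Qed.

HB.instance Definition _ := GRing.isMonoidMorphism.Build FG KG FG_incl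
  FG_incl_monoid_morphism.

(* A left FG-submodule is in particular an F-subspace, hence the carrier. *)
Record additive_code := AdditiveCode {
  code_space :> {vspace KG};
  code_closed : forall (x : FG) (c : KG),
    c \in code_space -> FG_incl x * c \in code_space
}.

(* TE: trace-Euclidean, TH: trace-Hermitian. *)
Inductive product_kind := TE | TH.

(* The conjugation b |-> b^(q^(m/2)); only meaningful when m is even. *)
Definition conjK (b : K) : K := b ^+ (#|F| ^ (\dim {:K})./2).

Definition trace_product (star : product_kind) (x y : KG) : F :=
  match star with
  | TE => field_trace (\sum_(g : gT) ga_coef x g * ga_coef y g)
  | TH => field_trace (\sum_(g : gT) ga_coef x g * conjK (ga_coef y g))
  end.

Definition dual (star : product_kind) (C : additive_code) (x : KG) : Prop :=
  forall c, c \in C -> trace_product star x c = 0.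

Definition LCD (star : product_kind) (C : additive_code) : Prop :=
  forall x : KG, (x \in C /\ dual star C x) <-> x = 0.

Definition rho (e : KG) : 'End(KG) := amulr e.

Definition rhoFG (e : KG) : 'Hom(FG, KG) := (rho e \o linfun FG_incl)%VF.

Lemma rhoE e x : rho e x = x * e. Proof. by rewrite lfunE. Qed.

Lemma rhoFGE e x : rhoFG e x = FG_incl x * e.
Proof. by rewrite lfunE /= !lfunE. Qed.

Lemma rho_FG_linear e (x : FG) (y : KG) :
  rho e (FG_incl x * y) = FG_incl x * rho e y.
Proof. by rewrite !rhoE mulrA. Qed.

Lemma rho_projector e : e * e = e -> (rho e \o rho e)%VF = rho e.
Proof. by move=> ee; apply/lfunP=> x; rewrite lfunE /= !rhoE -mulrA ee. Qed.

Lemma FGe_closed e (x : FG) (c : KG) :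
  c \in limg (rhoFG e) -> FG_incl x * c \in limg (rhoFG e).
Proof.
case/memv_imgP=> y _ ->; apply/memv_imgP; exists (x * y); rewrite ?memvf //.
by rewrite !rhoFGE rmorphM mulrA.
Qed.

Definition FGe (e : KG) : additive_code := AdditiveCode (@FGe_closed e).

Definition form_e (star : product_kind) (e : KG) (x y : FG) : F :=
  trace_product star (FG_incl x * e) (FG_incl y * e).

Definition ker_e (e : KG) : {vspace FG} := lker (rhoFG e).

Definition gram_e (star : product_kind) (e : KG) n (X : n.-tuple FG)
    : 'M[F]_n :=
  \matrix_(i, j) form_e star e (tnth X i) (tnth X j).

End RestrictedIdempotentCode.

(* Main.v *)
Require Import Defs.
From HB Require Import structures.
From mathcomp Require Import all_boot all_order all_fingroup all_algebra.
From mathcomp Require Import all_solvable all_field.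

Set Implicit Arguments.
Unset Strict Implicit.
Unset Printing Implicit Defensive.

Import GRing.Theory.
Local Open Scope ring_scope.
Local Open Scope quotient_scope.

(* The form (x, y) |-> <xe, ye> on FG vanishes as soon as xe = 0 or ye = 0, so  *)
(* both its radicals contain ker rho_e, and each of the conditions (1)-(4) says *)
(* that the left radical is no larger.  For (4), the left kernel of the Gram    *)
(* matrix is the left radical in coordinates, so its rank is at most            *)
(* dim FG - dim ker rho_e = dim FGe, with equality exactly when the left        *)
(* radical is ker rho_e.                                                        *)

(** Every element of FGe is some ye, so the LCD property says exactly that the left radical lies in
    the kernel of [rhoFG e]. The rank criterion [mxrank_gramP] turns this into the condition on Gram
    matrices, and [right_radical_sub_ker] carries it over to the right radical. [quotient_formE]
    lets the form descend to the quotient by the kernel. *)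

Section GramMatrix.
Import VectorInternalTheory.
Variables (F : fieldType) (U V : vectType F).

Lemma mul_b2mx n (X : n.-tuple V) (u : 'rV[F]_n) :
  u *m b2mx X = v2r (\sum_i u 0 i *: tnth X i).
Proof.
rewrite mulmx_sum_row linear_sum; apply: eq_bigr => i _.
by rewrite linearZ rowK.
Qed.

Lemma mxrank_b2mx n (X : n.-tuple V) : \rank (b2mx X) = \dim <<X>>.
Proof.
have -> : <<X>>%VS = mx2vs (b2mx X).
  (* The span is locked and built from the tuple retyped at the length of its sequence; destructing
     the length equation removes the cast. *)
  by rewrite unlock tvalK; case: _ / (esym _).
by rewrite /dimv mx2vsK.
Qed.

Lemma basis_sumP n (X : n.-tuple U) : basis_of fullv X ->
  forall x, exists u : 'rV[F]_n, x = \sum_i u 0 i *: tnth X i.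
Proof.
move=> Xbasis x; exists (\row_i coord X i x).
rewrite {1}(coord_basis Xbasis (memvf x)).
by apply: eq_bigr => i _; rewrite mxE -tnth_nth.
Qed.

(** Entry j of the product is [b] at the vector with coordinates [u] and the j-th basis vector, and
    vanishing on a basis suffices by linearity. *)
Lemma mulmx_gram_eq0 (b : U -> U -> F) n (X : n.-tuple U) :
    bilinear_for *%R *%R b -> basis_of fullv X ->
  forall u : 'rV[F]_n,
  (u *m (\matrix_(i, j) b (tnth X i) (tnth X j)) = 0) <->
  (forall y, b (\sum_i u 0 i *: tnth X i) y = 0).
Proof.
move=> [linl linr] Xbasis u.
pose bl y : {scalar U} :=
  HB.pack (b^~ y) (GRing.isLinear.Build _ _ _ _ _ (linl y)).
pose br x : {scalar U} :=
  HB.pack (b x) (GRing.isLinear.Build _ _ _ _ _ (linr x)).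
have rowE j : (u *m \matrix_(i, j) b (tnth X i) (tnth X j)) 0 j
              = b (\sum_i u 0 i *: tnth X i) (tnth X j).
  rewrite mxE -[RHS]/(bl _ _) linear_sum; apply: eq_bigr => i _.
  by rewrite linearZ mxE.
split=> [uM0 y | b0]; last by apply/rowP=> j; rewrite rowE b0 mxE.
have [v ->] := basis_sumP Xbasis y.
rewrite -[LHS]/(br _ _) linear_sum big1 // => j _.
by rewrite linearZ /= -rowE uM0 mxE mulr0.
Qed.

(** In coordinates, the kernel of [f] and the left radical are the left kernels of [E] and [M]. The
    first lies in the second, so they coincide exactly when [M] has the rank of [E], which is the
    dimension of the image. *)
Lemma mxrank_gramP (b : U -> U -> F) (f : 'Hom(U, V)) n (X : n.-tuple U) :
    bilinear_for *%R *%R b -> basis_of fullv X ->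
    (forall x, f x = 0 -> forall y, b x y = 0) ->
  (\rank (\matrix_(i, j) b (tnth X i) (tnth X j)) = \dim (limg f)) <->
  (forall x, (forall y, b x y = 0) -> f x = 0).
Proof.
move=> b_lin Xbasis bf0.
set M := \matrix_(i, j) _; pose E := b2mx (map_tuple f X).
have fE u : u *m E = v2r (f (\sum_i u 0 i *: tnth X i)).
  rewrite mul_b2mx [f _]linear_sum; congr (v2r _).
  by apply: eq_bigr => i _; rewrite linearZ tnth_map.
have E0 (u : 'rV_n) : (u <= kermx E)%MS <-> f (\sum_i u 0 i *: tnth X i) = 0.
  split=> [/sub_kermxP|fu0]; last by apply/sub_kermxP; rewrite fE fu0 linear0.
  by rewrite fE => /(congr1 r2v); rewrite v2rK linear0.
have M0 (u : 'rV_n) : (u <= kermx M)%MS <-> forall y, b (\sum_i u 0 i *: tnth X i) y = 0.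
  have gram0 := mulmx_gram_eq0 b_lin Xbasis u.
  by split=> [/sub_kermxP/gram0 // | /gram0/sub_kermxP].
have rankE : \rank E = \dim (limg f).
  rewrite mxrank_b2mx -limg_span; congr (\dim (_ @: _)).
  by apply: span_basis.
have subEM : (kermx E <= kermx M)%MS.
  by apply/rV_subP=> u /E0 fu0; apply/M0; apply: bf0.
have subME : reflect (\rank M = \dim (limg f)) (kermx M <= kermx E)%MS.
  rewrite -rankE -(mxrank_leqif_sup subEM).2 !mxrank_ker.
  apply: (iffP eqP) => [eqr|-> //].
  (* Subtraction is truncated: cancelling n needs both ranks to be at most n. *)
  by rewrite -(subKn (rank_leq_row M)) -eqr subKn ?rank_leq_row.
split=> [/subME/rV_subP subK x bx0 | sub_rad].
  have [u xE] := basis_sumP Xbasis x.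
  by rewrite xE; apply/E0/subK/M0; rewrite -xE.
by apply/subME/rV_subP=> u /M0 /sub_rad /E0.
Qed.

(* The Gram matrix and its transpose have the same rank. *)
Lemma right_radical_sub_ker (b : U -> U -> F) (f : 'Hom(U, V)) :
    bilinear_for *%R *%R b ->
    (forall x y, f x = 0 \/ f y = 0 -> b x y = 0) ->
  (forall x, (forall y, b x y = 0) -> f x = 0) ->
  forall y, (forall x, b x y = 0) -> f y = 0.
Proof.
move=> b_lin bf0 radl.
have tr_lin : bilinear_for *%R *%R (fun x y => b y x).
  by case: b_lin => linl linr; split.
have Xbasis := vbasisP {:U}.
apply/(mxrank_gramP tr_lin Xbasis); first by move=> x fx0 y; apply: bf0; right.
have <- := (mxrank_gramP b_lin Xbasis
  (fun x fx0 y => bf0 x y (or_introl fx0))).2 radl.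
by rewrite -mxrank_tr; congr (\rank _); apply/matrixP=> i j; rewrite !mxE.
Qed.

End GramMatrix.

Lemma scalar0 (R : pzRingType) (U : lmodType R) (f : U -> R) :
  scalar f -> f 0 = 0.
Proof.
by move=> f_lin; have := f_lin (-1) 0 0; rewrite scaler0 addr0 /= mulN1r addNr.
Qed.

Section TraceProduct.
Variables (F : finFieldType) (K : fieldExtType F) (gT : finGroupType).
Local Notation KG := (group_algebra K gT).
Local Notation FG := (group_algebra F^o gT).

(** The identity is checked after embedding F in K, where the trace is a sum of F-linear Galois
    automorphisms. *)
Lemma scalar_field_trace : scalar (@field_trace F K).
Proof.
move=> c a b; apply: (@fmorph_inj _ _ (in_alg K)).
rewrite [RHS]rmorphD [X in _ = X + _]rmorphM /= !field_traceE raddfD /=.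
rewrite mulr_algl; congr (_ + _).
rewrite /galTrace scaler_sumr; apply: eq_bigr => s _.
exact: linearZ.
Qed.

(** The exponent is a power of q: scalars are fixed because c^q = c on F, and sums are preserved
    because q is a power of the characteristic. *)
Lemma conjK_is_linear : linear (@conjK F K).
Proof.
move=> c a b; rewrite /conjK.
have [p p_pr pF] := finPcharP F.
have ck k : c ^+ (#|F| ^ k) = c.
  by elim: k => // k IHk; rewrite expnS exprM expf_card.
rewrite exprDn_pchar ?exprZn ?ck //.
have pK : p \in [pchar K] by rewrite (fmorph_pchar (in_alg K)).
rewrite pnatX (eq_pnat _ (pcharf_eq pK)).
(* The additive group of F is an elementary abelian p-group, so q is a power of p. *)
have /abelem_pgroup := fin_ring_pchar_abelem pF.
by rewrite /pgroup cardsT => ->.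
Qed.
HB.instance Definition _ :=
  GRing.isLinear.Build F K K _ (@conjK F K) conjK_is_linear.

Lemma trace_product_bilinear (star : product_kind) :
  bilinear_for *%R *%R (@trace_product F K gT star).
Proof.
split=> [z c x y | z c x y]; case: star;
  apply: etrans (scalar_field_trace _ _ _); congr field_trace;
  rewrite scaler_sumr -big_split /=; apply: eq_bigr => g _; rewrite /ga_coef !ffunE.
- by rewrite mulrDl scalerAl.
- by rewrite mulrDl scalerAl.
- by rewrite mulrDr scalerAr.
- by rewrite linearP mulrDr scalerAr.
Qed.

Variables (star : product_kind) (e : KG).

Lemma form_e_bilinear : bilinear_for *%R *%R (form_e star e : FG -> FG -> F).
Proof.
have [linl linr] := trace_product_bilinear star.
by split=> [z c x y | z c x y]; rewrite /form_e linearP mulrDl -scalerAl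
  ?linl ?linr.
Qed.

Lemma ker_eP x : reflect (FG_incl K x * e = 0) (x \in ker_e e).
Proof. by rewrite memv_ker rhoFGE; apply: eqP. Qed.

Lemma form_e_eq0 (x y : FG) : rhoFG e x = 0 \/ rhoFG e y = 0 ->
  form_e star e x y = 0.
Proof.
have [linl linr] := trace_product_bilinear star.
rewrite !rhoFGE /form_e; case=> ->; first exact: (scalar0 (linl _)).
exact: (scalar0 (linr _)).
Qed.

Definition quotient_form (x y : quotient_space (ker_e e)) : F :=
  form_e star e (generic_quotient.repr x) (generic_quotient.repr y).

(** A representative of the class of z differs from z by an element of the kernel, so both have the
    same product with [e]. *)
Lemma quotient_formE (x y : FG) :
  quotient_form (\pi x) (\pi y) = form_e star e x y.
Proof.
have reprE z : FG_incl K (generic_quotient.repr (\pi_(quotient_space (ker_e e)) z)) * e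
                = FG_incl K z * e.
  apply/eqP; rewrite -subr_eq0 -mulrBl -raddfB; apply/eqP/ker_eP.
  by rewrite -pi_qs_eq0 raddfB /= reprK subrr.
by rewrite /quotient_form /form_e !reprE.
Qed.

Lemma quotient_form_bilinear : bilinear_for *%R *%R quotient_form.
Proof.
have [linl linr] := form_e_bilinear.
split=> z c x y; rewrite -[x]reprK -[y]reprK -[z]reprK.
  by rewrite -pi_qs_linear !quotient_formE linl.
by rewrite -pi_qs_linear !quotient_formE linr.
Qed.

HB.instance Definition _ := bilinear_isBilinear.Build F
  (quotient_space (ker_e e)) (quotient_space (ker_e e)) F *%R *%R
  quotient_form quotient_form_bilinear.

End TraceProduct.

Theorem theorem3p25 (F : finFieldType) (K : fieldExtType F)
    (gT : finGroupType) (star : product_kind) (e : group_algebra K gT)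
    (m_even : star = TH -> ~~ odd (\dim {:K})) (e_idem : e * e = e) :
  (forall x : group_algebra F^o gT,
     [<-> x \in ker_e e;
          FG_incl K x * e = 0;
          exists y : group_algebra K gT, FG_incl K x = y * (1 - e)])
  /\
  [<-> LCD star (FGe e);

       forall x : group_algebra F^o gT,
         (forall y : group_algebra F^o gT,
            trace_product star (FG_incl K x * e) (FG_incl K y * e) = 0) ->
         FG_incl K x * e = 0;

       exists B : {bilinear quotient_space (ker_e e) ->
                     quotient_space (ker_e e) -> F | *%R & *%R},
         (forall x y : group_algebra F^o gT,
            B (\pi_(quotient_space (ker_e e)) x)
              (\pi_(quotient_space (ker_e e)) y) = form_e star e x y)
         /\ nondegenerate_form B;

       forall X : #|gT|.-tuple (group_algebra F^o gT),
         basis_of fullv X -> \rank (gram_e star e X) = \dim (FGe e)].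
Proof.
have b_lin := @form_e_bilinear F K gT star e.
have form0 := @form_e_eq0 F K gT star e.
have form0l x (xe0 : rhoFG e x = 0) y := form0 x y (or_introl xe0).
split=> [x|]; first tfae.
- by move/ker_eP.
- by move=> xe0; exists (FG_incl K x); rewrite mulrBr mulr1 xe0 subr0.
- case=> y xE; apply/ker_eP.
  by rewrite xE -mulrA mulrBl mul1r e_idem subrr mulr0.
tfae.
- move=> lcd x xrad; apply/lcd; split.
    by rewrite -rhoFGE memv_img ?memvf.
  by move=> _ /memv_imgP[y _ ->]; rewrite rhoFGE.
- move=> radl; exists (@quotient_form F K gT star e).
  have radl' x : (forall y, form_e star e x y = 0) -> rhoFG e x = 0.
    by rewrite rhoFGE; apply: radl.
  split; first exact: quotient_formE.
  split=> x; rewrite -[x]reprK => x0; apply/eqP;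
    rewrite pi_qs_eq0 memv_ker; apply/eqP.
    by apply: radl' => y; rewrite -quotient_formE; exact: x0.
  (* The hypothesis only controls the left radical; equality of row and column rank gives the right
     one. *)
  apply: (right_radical_sub_ker b_lin form0 radl') => y.
  by rewrite -quotient_formE; exact: x0.
- case=> B [BE [radl _]] X Xbasis.
  apply: (mxrank_gramP b_lin Xbasis form0l).2 => x x0.
  apply/eqP; rewrite -memv_ker -pi_qs_eq0; apply/eqP/radl => y.
  by rewrite -[y]reprK BE.
- move=> rank_gram x; split=> [[/memv_imgP[y _ ->]] y0 | ->]; last first.
    split; first exact: mem0v.
    move=> c _; have [linl _] := @trace_product_bilinear F K gT star.
    exact: (scalar0 (linl c)).
  have dimFG : \dim {:group_algebra F^o gT} = #|gT|.
    by rewrite dimvf; apply: muln1.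
  have Xbasis := vbasisP {:group_algebra F^o gT}.
  (* The basis is generalized so that its length, the dimension of FG, can be rewritten to the order
     of the group. *)
  move: (vbasis _) Xbasis; rewrite dimFG => X Xbasis.
  apply: (mxrank_gramP b_lin Xbasis form0l).1 (rank_gram X Xbasis) _ _ => z.
  by rewrite /form_e -!rhoFGE; apply/y0/memv_img/memvf.
Qed.
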